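(* Let $I$ be a monomial ideal of $S=K[t_1,\ldots,t_s]$ and let $I=\mathfrak{q}_1\cap\cdots\cap\mathfrak{q}_m$ be its irreducible decomposition. Suppose that $I$ has no embedded associated primes, ${\rm rad}(\mathfrak{q}_j)\neq{\rm rad}(\mathfrak{q}_i)$ for $j\neq i$, and $\mathfrak{q}_i$ is normal for all $i$. The following conditions are equivalent. (a) ${\rm IP}(I)$ is integral. (b) ${\rm NP}(I)={\rm IP}(I)$. (c) $\overline{I^n}=I^{(n)}$ for all $n\geq 1$.
   Context: $K$ is a field, $\mathbb{N}=\{0,1,\ldots\}$, $\mathbb{R}_+$ is the set of non-negative reals, $t^a=t_1^{a_1}\cdots t_s^{a_s}$ for $a\in\mathbb{N}^s$, and $e_i$ is the $i$-th unit vector of $\mathbb{R}^s$. Monomial ideals are nonzero and proper; $\overline{L}$ is the integral closure of an ideal $L$; a monomial ideal $L$ is normal if $L^n=\overline{L^n}$ for all $n\geq 1$. If $I$ has minimal primes $\mathfrak{p}_1,\ldots,\mathfrak{p}_r$, its $n$-th symbolic power is $I^{(n)}=\bigcap_{i=1}^r(I^nS_{\mathfrak{p}_i}\cap S)$. If $I$ is minimally generated by $t^{v_1},\ldots,t^{v_q}$, its Newton polyhedron is ${\rm NP}(I)=\mathbb{R}_+^s+{\rm conv}(v_1,\ldots,v_q)$. For $b\in\mathbb{N}^s\setminus\{0\}$, set $\mathfrak{q}_b:=(\{t_i^{b_i}\mid b_i\geq 1\})$ and $b^{-1}:=\sum_{b_i\geq 1}b_i^{-1}e_i$. The irreducible decomposition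 of $I$ is the unique (up to order) expression $I=\mathfrak{q}_1\cap\cdots\cap\mathfrak{q}_m$ where each $\mathfrak{q}_i=\mathfrak{q}_{\alpha_i}$ for some $\alpha_i\in\mathbb{N}^s\setminus\{0\}$ and $I\neq\bigcap_{i\neq j}\mathfrak{q}_i$ for $j=1,\ldots,m$. The irreducible polyhedron of $I$ is ${\rm IP}(I)=\{x\in\mathbb{R}^s\mid x\geq 0;\ \langle x,\alpha_i^{-1}\rangle\geq 1 \text{ for } i=1,\ldots,m\}$. It is integral if all its vertices have integer entries. *)

(* Defs.v *)
From HB Require Import structures.
From mathcomp Require Import all_boot all_order all_algebra fraction.
From mathcomp Require Import classical_sets reals.
From mathcomp Require Import mpoly.

Set Implicit Arguments.
Unset Strict Implicit.
Unset Printing Implicit Defensive.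

Import Order.TTheory GRing.Theory Num.Theory.

Local Open Scope classical_set_scope.
Local Open Scope ring_scope.

Section Ideals.
Variable A : comNzRingType.
Implicit Types (I J P L G : set A) (n : nat).

Definition is_ideal I :=
  [/\ I 0, forall x y, I x -> I y -> I (x + y) & forall a x, I x -> I (a * x)].

Definition ideal_gen G : set A := smallest is_ideal G.

Definition ideal_mul I J : set A :=
  ideal_gen [set z | exists x y, [/\ I x, J y & z = x * y]].

Fixpoint ideal_pow I n : set A :=
  if n is n'.+1 then ideal_mul I (ideal_pow I n') else setT.

Definition radical I : set A := [set x | exists2 n, (1 <= n)%N & I (x ^+ n)].

Definition prime_ideal P :=
  [/\ is_ideal P, ~ P 1 & forall x y, P (x * y) -> P x \/ P y].

Definition minimal_prime I P :=
  [/\ prime_ideal P, I `<=` P &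
      forall Q, prime_ideal Q -> I `<=` Q -> Q `<=` P -> Q = P].

Definition associated_prime I P :=
  prime_ideal P /\ exists f, P = [set g | I (g * f)].

Definition no_embedded_primes I :=
  forall P, associated_prime I P -> minimal_prime I P.

(* x ^ n + a_1 x ^ (n - 1) + ... + a_n = 0 with n >= 1 and a_i in L ^ i *)
Definition integral_closure L : set A :=
  [set x | exists n (a : nat -> A),
     [/\ (1 <= n)%N,
         forall i, (1 <= i <= n)%N -> ideal_pow L i (a i) &
         x ^+ n + \sum_(1 <= i < n.+1) a i * x ^+ (n - i) = 0]].

Definition normal_ideal L :=
  forall n, (1 <= n)%N -> ideal_pow L n = integral_closure (ideal_pow L n).

End Ideals.

Section SymbolicPower.
Variable A : idomainType.

(* The extension J A_P of J to the localization A_P, as a subset of Frac(A). *)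
Definition localized_ideal (J P : set A) : set {fraction A} :=
  [set z | exists a g, [/\ J a, ~ P g & z = tofrac a / tofrac g]].

Definition symbolic_power (I : set A) (n : nat) : set A :=
  \bigcap_(P in minimal_prime I)
    (@tofrac A @^-1` localized_ideal (ideal_pow I n) P).

End SymbolicPower.

Section MonomialIdeals.
Variables (K : fieldType) (s : nat).
Local Notation S := {mpoly K[s]}.
Implicit Types (I : set S) (b : 'X_{1..s}).

Definition mono_ideal (E : set 'X_{1..s}) : set S :=
  ideal_gen [set ('X_[a] : S) | a in E].

Definition monomial_ideal I :=
  [/\ exists E, I = mono_ideal E, I <> [set 0] & I <> setT].

Definition minimally_generated I q (v : 'I_q -> 'X_{1..s}) :=
  I = mono_ideal (range v) /\
  forall j, I <> mono_ideal [set v i | i in [set i | i != j]].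

Definition irr_ideal b : set S :=
  ideal_gen [set ('X_i : S) ^+ b i | i in [set i | (1 <= b i)%N]].

Definition irreducible_decomposition I m (alpha : 'I_m -> 'X_{1..s}) :=
  [/\ forall i, alpha i != 0%MM,
      I = \bigcap_(i in [set: 'I_m]) irr_ideal (alpha i) &
      forall j, I <> \bigcap_(i in [set i | i != j]) irr_ideal (alpha i)].

End MonomialIdeals.

Section Polyhedra.
Variables (R : realType) (s : nat).
Implicit Types (x y c : 'rV[R]_s) (P : set 'rV[R]_s).

Definition dotv x y : R := \sum_(i < s) x 0 i * y 0 i.

Definition nonneg_orthant : set 'rV[R]_s := [set x | forall i, 0 <= x 0 i].

Definition conv q (v : 'I_q -> 'rV[R]_s) : set 'rV[R]_s :=
  [set x | exists c : 'I_q -> R,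
     [/\ forall i, 0 <= c i, \sum_i c i = 1 & x = \sum_i c i *: v i]].

Definition mnm_vec (a : 'X_{1..s}) : 'rV[R]_s := \row_i (a i)%:R.

(* The minimal monomial generators are unique up to order, so the choice of
   [v] below is immaterial. *)
Definition newton_polyhedron (K : fieldType) (I : set {mpoly K[s]}) :
    set 'rV[R]_s :=
  [set x | exists q (v : 'I_q -> 'X_{1..s}), minimally_generated I v /\
     exists y z, [/\ nonneg_orthant y, conv (fun i => mnm_vec (v i)) z &
                     x = y + z]].

Definition inv_vec (b : 'X_{1..s}) : 'rV[R]_s :=
  \row_i (if (1 <= b i)%N then (b i)%:R^-1 else 0).

Definition irreducible_polyhedron m (alpha : 'I_m -> 'X_{1..s}) :
    set 'rV[R]_s :=
  [set x | nonneg_orthant x /\ forall i, 1 <= dotv x (inv_vec (alpha i))].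

(* A vertex is a face consisting of a single point. *)
Definition is_vertex P x :=
  exists c (beta : R), (forall y, P y -> beta <= dotv c y) /\
    [set y | P y /\ dotv c y = beta] = [set x].

Definition integral_polyhedron P :=
  forall x, is_vertex P x -> forall i, x 0 i \is a Num.int.

End Polyhedra.

Arguments newton_polyhedron R {s K} I.
Arguments irreducible_polyhedron R {s m} alpha.
Arguments irr_ideal K {s} b.

(* Main.v *)
From HB Require Import structures.
Require Import Defs.
From mathcomp Require Import all_boot all_order all_algebra fraction.
From mathcomp Require Import boolp classical_sets reals.
From mathcomp Require Import mpoly.
From mathcomp Require Import ring lra.

(** Everything is read off exponents: a monomial t^a belongs to the closure of
    I^n or to the n-th symbolic power according to the position of the point
    a / n with respect to NP(I) or IP(I).

    On the side of IP(I), the absence of embedded primes and the distinctness of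
    the radicals make the ideals rad(q_i) the minimal primes of I, pairwise
    incomparable. Hence I and q_i agree locally at rad(q_i), and I^(n) is the
    intersection of the q_i^n ([symbolic_powerE]). Since q_i is normal, t^a lies
    in q_i^n exactly when <a, alpha_i^-1> >= n ([normal_irr_ideal_powX]), so t^a
    lies in I^(n) exactly when a / n lies in IP(I) ([symbolic_powerX]).

    On the side of NP(I), if t^a is integral over I^n, then a multiple i a with
    i >= 1 dominates a sum of i n exponents of I ([integral_closure_mono_pow]).
    Conversely, if a / n lies in NP(I), then a power (t^a)^N lies in (I^n)^N
    ([nfold_newton_of]), and sums of such terms are integral over I^n
    ([integral_closure_sum_roots]).

    NP(I) is always contained in IP(I), because the exponents of I lie in IP(I).
    If IP(I) is integral, its vertices are exponents of I, and they generate
    IP(I) by convex combinations and nonnegative vectors ([polyhedron_ind]); so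
    (a) implies (b). The two descriptions of monomials show that (b) gives (c).
    For (c) implies (a), a vertex of IP(I) is rational, x = a / n
    ([basic_point_rational]); as t^a is integral over I^n, the point x dominates
    an average of exponents of I, which are integer points of IP(I), and the
    extremality of x forces them to coincide with x. *)

Set Implicit Arguments.
Unset Strict Implicit.
Unset Printing Implicit Defensive.

Import Order.TTheory GRing.Theory Num.Theory.

Local Open Scope ring_scope.

(** * Ideals, their powers and integral closure *)

Section IdealTheory.
Local Open Scope classical_set_scope.
Variable A : comNzRingType.
Implicit Types (I J G : set A) (n : nat) (x y : A).

Lemma ideal_gen_is_ideal G : is_ideal (ideal_gen G).
Proof.
split=> [J [[J0 _ _] _]//|x y Gx Gy J [JI GJ]|a x Gx J [JI GJ]].
  by case: (JI) => _ + _; apply; [apply: Gx|apply: Gy].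
by case: (JI) => _ _; apply; apply: Gx.
Qed.

Lemma sub_ideal_gen G : G `<=` ideal_gen G.
Proof. exact: sub_gen_smallest. Qed.

Lemma ideal_gen_sub G J : is_ideal J -> G `<=` J -> ideal_gen G `<=` J.
Proof. by move=> idJ GJ; apply: smallest_sub. Qed.

Lemma is_ideal_sum J (T : eqType) (r : seq T) (F : T -> A) :
  is_ideal J -> (forall i, i \in r -> J (F i)) -> J (\sum_(i <- r) F i).
Proof.
move=> [J0 JD _] JF; rewrite big_seq.
by apply: (big_ind J) => // i ir; apply: JF.
Qed.

Lemma ideal_mulr J a x : is_ideal J -> J x -> J (x * a).
Proof. by case=> _ _ JM Jx; rewrite mulrC; apply: JM. Qed.

Lemma ideal_pow_is_ideal I n : is_ideal (ideal_pow I n).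
Proof. by case: n => [|n]; [split|exact: ideal_gen_is_ideal]. Qed.

Lemma ideal_powS_mem I n x y :
  I x -> ideal_pow I n y -> ideal_pow I n.+1 (x * y).
Proof. by move=> Ix Iy; apply: sub_ideal_gen; exists x, y. Qed.

Lemma ideal_pow_mul I k n x y :
  ideal_pow I k x -> ideal_pow I n y -> ideal_pow I (k + n) (x * y).
Proof.
move=> + Iy; elim: k x => [|k IHk] x.
  by move=> _; case: (ideal_pow_is_ideal I n) => _ _; apply.
move: x; apply: ideal_gen_sub => [|_ [a [b [Ia Ib ->]]]]; last first.
  by rewrite -mulrA addSn; apply: ideal_powS_mem => //; apply: IHk.
have [I0 ID IM] := ideal_pow_is_ideal I (k.+1 + n).
split=> [|a b Ia Ib|a b Ib]; first by rewrite mul0r.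
  by rewrite mulrDl; apply: ID.
by rewrite -mulrA; apply: IM.
Qed.

Lemma ideal_pow_mono I J n : I `<=` J -> ideal_pow I n `<=` ideal_pow J n.
Proof.
move=> IJ; elim: n => [//|n IHn].
apply: ideal_gen_sub => [|_ [a [b [Ia Ib ->]]]].
  exact: ideal_pow_is_ideal.
by apply: ideal_powS_mem; [apply: IJ|apply: IHn].
Qed.

Lemma ideal_pow1 I : is_ideal I -> ideal_pow I 1 = I.
Proof.
move=> idI; apply/seteqP; split=> [|x Ix].
  by apply: ideal_gen_sub => // _ [a [b [Ia _ ->]]]; apply: ideal_mulr.
by rewrite -[x]mulr1; apply: ideal_powS_mem.
Qed.

Lemma integral_closure_mono I J :
  I `<=` J -> integral_closure I `<=` integral_closure J.
Proof.
move=> IJ x [n [a [n0 Ia eq0]]]; exists n, a; split=> // i /Ia.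
exact: ideal_pow_mono.
Qed.

Section ReesAlgebra.
Variable J : set A.
Implicit Types p q : {poly A}.

(** The Rees algebra of J inside A[T]. An element x is integral over the ideal
    J as soon as x T is integral over this ring, so that the closure of
    integral elements under addition becomes available for ideals. *)
Definition rees : {pred {poly A}} :=
  fun p => `[< forall i, ideal_pow J i p`_i >].

Lemma reesP p : reflect (forall i, ideal_pow J i p`_i) (p \in rees).
Proof. exact: asboolP. Qed.

Lemma rees_subring_closed : subring_closed rees.
Proof.
split=> [|p q /reesP Jp /reesP Jq|p q /reesP Jp /reesP Jq]; apply/reesP => i.
- have [I0 _ _] := ideal_pow_is_ideal J i.
  by rewrite coef1; case: i I0.
- have [_ ID IM] := ideal_pow_is_ideal J i.
  by rewrite coefB -mulN1r; apply: ID => //; apply: IM.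
- rewrite coefM; apply: is_ideal_sum => [|j _]; first exact: ideal_pow_is_ideal.
  rewrite -[X in ideal_pow J X _](subnKC (leq_ord j)).
  exact: ideal_pow_mul.
Qed.
HB.instance Definition _ :=
  GRing.isSubringClosed.Build {poly A} rees rees_subring_closed.

Record rees_ring := ReesRing {rees_val : {poly A}; _ : rees_val \in rees}.
HB.instance Definition _ := [isSub for rees_val].
HB.instance Definition _ := [Choice of rees_ring by <:].
HB.instance Definition _ := [SubChoice_isSubComNzRing of rees_ring by <:].

Definition rees_emb : rees_ring -> {poly A} := val.
HB.instance Definition _ := GRing.RMorphism.copy rees_emb val.

(** If x ^ k lies in J ^ k, then x T is a root of X ^ k - (x T) ^ k, a monic
    polynomial over the Rees algebra. *)
Lemma rees_integral_root k x : (1 <= k)%N -> ideal_pow J k (x ^+ k) ->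
  integralOver rees_emb (x *: 'X).
Proof.
move=> k0 Jx; pose u := (x ^+ k) *: 'X^k : {poly A}.
have uR : u \in rees.
  apply/reesP => i; rewrite coefZ coefXn; case: eqP => [->|_].
    by rewrite mulr1.
  by rewrite mulr0; case: (ideal_pow_is_ideal J i).
exists ('X^k - (ReesRing uR)%:P); first exact: monicXnsubC.
by rewrite rmorphB /= map_polyXn map_polyC rootE !hornerE exprZn subrr.
Qed.

(** In a monic equation for x T over the Rees algebra, the coefficients of
    T ^ n, where n is the degree of the equation, form an equation of integral
    dependence of x over J. *)
Lemma integral_closure_rees x :
  integralOver rees_emb (x *: 'X) -> integral_closure J x.
Proof.
case=> p pm; rewrite rootE.
have [->|p1] := eqVneq p 1.
  by rewrite rmorph1 hornerC (negPf (oner_neq0 _)).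
set n := (size p).-1.
have sp : size p = n.+1.
  by rewrite prednK // lt0n size_poly_eq0 monic_neq0.
have n0 : (1 <= n)%N.
  case: (posnP n) sp => // -> /eqP/size_poly1P[c _ pc].
  by move: pm p1; rewrite pc monicE lead_coefC => /eqP ->; rewrite eqxx.
have spm : size (map_poly rees_emb p) = n.+1.
  rewrite size_map_poly_id0 ?sp// (monicP pm).
  by rewrite (rmorph1 rees_emb) oner_neq0.
rewrite horner_coef spm => /eqP/(congr1 (fun q : {poly A} => q`_n)).
rewrite coef0 coef_sum => eq0.
exists n, (fun i => (rees_emb p`_(n - i))`_i); split=> // [i _|].
  exact/reesP/valP.
rewrite -[RHS]eq0 big_add1 /= big_mkord [RHS](reindex_inj rev_ord_inj) /=.
rewrite big_ord_recl /= subSS subn0 coef_map_id0 ?raddf0//.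
have E (i : nat) : (i <= n)%N ->
    (rees_emb p`_(n - i) * (x *: 'X) ^+ (n - i))`_n
    = (rees_emb p`_(n - i))`_i * x ^+ (n - i).
  move=> lein; rewrite exprZn -scalerAr coefZ coefMXn.
  by rewrite ltnNge leq_subr /= subKn // mulrC.
rewrite -[X in p`_X](subn0 n) -[X in (x *: 'X) ^+ X](subn0 n) E // !subn0.
have -> : p`_n = 1 by rewrite -(monicP pm) lead_coefE.
rewrite coef1 eqxx mul1r; congr (_ + _); apply: eq_bigr => i _.
by rewrite subSS /bump /= add1n coef_map_id0 ?raddf0// E.
Qed.

(** Each summand is integral on its own; over the Rees algebra, integral
    elements can be added. *)
Lemma integral_closure_sum_roots (T : eqType) (r : seq T) (F : T -> A) :
  (forall i, i \in r -> exists2 k, (1 <= k)%N & ideal_pow J k (F i ^+ k)) ->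
  integral_closure J (\sum_(i <- r) F i).
Proof.
move=> rootF; apply: integral_closure_rees; rewrite scaler_suml big_seq.
apply: (big_ind (integralOver rees_emb)).
- exact: integral0.
- exact: integral_add.
- by move=> i /rootF[k k0 Jk]; apply: rees_integral_root k0 Jk.
Qed.

End ReesAlgebra.

Lemma integral_closure_root J k x :
  (1 <= k)%N -> ideal_pow J k (x ^+ k) -> integral_closure J x.
Proof.
move=> k0 Jx; rewrite -[x](big_seq1 +%R x id).
by apply: integral_closure_sum_roots => y; rewrite inE => /eqP ->; exists k.
Qed.

End IdealTheory.

(** * Polyhedra: vertices, generation and rationality *)

Section DotProduct.
Variables (R : realType) (d : nat).
Implicit Types x y z : 'rV[R]_d.

Lemma dotvC x y : dotv x y = dotv y x.
Proof. by apply: eq_bigr => i _; rewrite mulrC. Qed.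

Lemma dotvDr x y z : dotv x (y + z) = dotv x y + dotv x z.
Proof. by rewrite -big_split; apply: eq_bigr => i _; rewrite mxE mulrDr. Qed.

Lemma dotvZr a x y : dotv x (a *: y) = a * dotv x y.
Proof. by rewrite mulr_sumr; apply: eq_bigr => i _; rewrite mxE mulrCA. Qed.

Lemma dotvNr x y : dotv x (- y) = - dotv x y.
Proof. by rewrite -scaleN1r dotvZr mulN1r. Qed.

Lemma dotv_sumr (T : finType) (P : pred T) x (F : T -> 'rV[R]_d) :
  dotv x (\sum_(i | P i) F i) = \sum_(i | P i) dotv x (F i).
Proof.
rewrite exchange_big; apply: eq_bigr => j _ /=.
by rewrite summxE mulr_sumr.
Qed.

Lemma dotv_deltal (i : 'I_d) x : dotv (delta_mx 0 i) x = x 0 i.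
Proof.
rewrite /dotv (bigD1 i)//= !mxE !eqxx mul1r big1 ?addr0// => j ji.
by rewrite mxE (negPf ji) andbF mul0r.
Qed.

End DotProduct.

Section Polyhedron.
Local Open Scope classical_set_scope.
Variables (R : realType) (d : nat) (T : finType).
Variables (A : T -> 'rV[R]_d) (b : T -> R).
Implicit Types (x y u : 'rV[R]_d) (k : T).

Definition polyhedron : set 'rV[R]_d :=
  [set x | forall k, b k <= dotv (A k) x].

(** A point at which the active constraints have no common direction left. This
    linear-algebra form of a vertex is the one that can be reached by moving
    along edges, and the one that is rational for rational data. *)
Definition basic_point x :=
  polyhedron x /\
  forall u, (forall k, dotv (A k) x = b k -> dotv (A k) u = 0) -> u = 0.

Definition slack x : {set T} := [set k | dotv (A k) x != b k]%SET.

(** Walk from x in a direction u that stays on all active constraints until the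
    first of the others, the one minimizing the ratio of slack to speed,
    becomes active. *)
Lemma move_to_facet x u :
  polyhedron x -> (forall k, dotv (A k) x = b k -> dotv (A k) u = 0) ->
  (exists k, dotv (A k) u < 0) ->
  exists2 t, 0 < t &
    polyhedron (x + t *: u) /\ (#|slack (x + t *: u)| < #|slack x|)%N.
Proof.
move=> Px tight0 [k0 k0neg].
case: (@Order.TotalTheory.arg_minP _ _ _ k0 (fun k => dotv (A k) u < 0)
  (fun k => (dotv (A k) x - b k) / - dotv (A k) u) k0neg) => k kneg kmin.
set t := (dotv (A k) x - b k) / - dotv (A k) u in kmin.
have kslack : dotv (A k) x != b k.
  by apply: contraTneq kneg => /tight0 ->; rewrite ltxx.
have t0 : 0 < t.
  by rewrite divr_gt0 ?oppr_gt0// subr_gt0 lt_neqAle eq_sym kslack Px.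
exists t => //; split=> [j|].
  rewrite dotvDr dotvZr; have [jneg|jpos] := ltP (dotv (A j) u) 0; last first.
    by rewrite (le_trans (Px j))// lerDl mulr_ge0// ltW.
  have := kmin _ jneg; rewrite ler_pdivlMr ?oppr_gt0// -/t; lra.
apply: proper_card; apply/properP; split.
  apply/fintype.subsetP => j; rewrite !inE; apply: contraNneq => xj.
  by rewrite dotvDr dotvZr xj tight0 // mulr0 addr0.
exists k; rewrite !inE// negbK dotvDr dotvZr /t.
by apply/eqP; field; rewrite lt_eqF.
Qed.

(** A polyhedron without lines is generated by its basic points under convex
    combinations and recession directions. At a point that is not basic some
    line stays on all active constraints: walking it both ways gives two points
    with fewer slack constraints and x between them; if one way is free, it is
    a recession direction and walking the other way is enough. *)
Lemma polyhedron_ind (C : set 'rV[R]_d) :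
    (forall x, basic_point x -> C x) ->
    (forall x y a, 0 <= a <= 1 -> C x -> C y -> C (a *: x + (1 - a) *: y)) ->
    (forall x u, (forall k, 0 <= dotv (A k) u) -> C x -> C (x + u)) ->
    (forall u, (forall k, dotv (A k) u = 0) -> u = 0) ->
  polyhedron `<=` C.
Proof.
move=> Cbasic Cconv Crec pointed x.
have [n] := ubnP #|slack x|; elim: n x => // n IHn x; rewrite ltnS => xn Px.
have [/Cbasic //|notbasic] := pselect (basic_point x).
have [u tight0 u0] : exists2 u,
    forall k, dotv (A k) x = b k -> dotv (A k) u = 0 & u != 0.
  apply: contrapT => nou; apply: notbasic; split=> // u tight0.
  by apply/eqP/negPn/negP => u0; apply: nou; exists u.
have step v : (forall k, dotv (A k) x = b k -> dotv (A k) v = 0) ->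
    (exists k, dotv (A k) v < 0) -> exists2 t, 0 < t & C (x + t *: v).
  move=> v0 vneg; have [t t0 [Pt slt]] := move_to_facet Px v0 vneg.
  by exists t => //; apply: IHn Pt; apply: leq_trans xn.
have oneway v : (forall k, dotv (A k) x = b k -> dotv (A k) v = 0) ->
    (forall k, 0 <= dotv (A k) v) -> v != 0 -> C x.
  move=> v0 vge0 vn0.
  have [k kpos] : exists k, 0 < dotv (A k) v.
    apply/not_existsP => npos; move/eqP: vn0; apply; apply: pointed => k.
    by apply/eqP; rewrite eq_le vge0 andbT leNgt; apply/negP.
  have [||t t0 Ct] := step (- v).
  - by move=> j /v0; rewrite dotvNr => ->; rewrite oppr0.
  - by exists k; rewrite dotvNr oppr_lt0.
  rewrite -(subrK (t *: v) x) -scalerN; apply: Crec => // j.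
  by rewrite dotvZr mulr_ge0// ltW.
have [neg|/forallNP nneg] := pselect (exists k, dotv (A k) u < 0); last first.
  by apply: (oneway u) => // k; rewrite leNgt; apply/negP.
have [pos|/forallNP npos] :=
  pselect (exists k, dotv (A k) (- u) < 0); last first.
  apply: (oneway (- u)) => //; last by rewrite oppr_eq0.
    by move=> j /tight0; rewrite dotvNr => ->; rewrite oppr0.
  by move=> k; rewrite leNgt; apply/negP.
have [t t0 Ct] := step _ tight0 neg.
have [|r r0 Cr] := step (- u) _ pos.
  by move=> j /tight0; rewrite dotvNr => ->; rewrite oppr0.
have tr0 : 0 < t + r by rewrite addr_gt0.
have -> : x = (r / (t + r)) *: (x + t *: u) +
    (1 - r / (t + r)) *: (x + r *: - u).
  apply/rowP => i; rewrite !mxE; field; exact: lt0r_neq0.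
apply: Cconv => //; apply/andP; split; first by rewrite divr_ge0 ?ltW.
by rewrite ler_pdivrMr// mul1r lerDr ltW.
Qed.

(** Take C empty in the induction principle. *)
Lemma exists_basic_point x :
    (forall u, (forall k, dotv (A k) u = 0) -> u = 0) ->
  polyhedron x -> exists y, basic_point y.
Proof.
move=> pointed Px; apply/not_existsP => nobasic.
by have := @polyhedron_ind set0; apply; last exact: Px.
Qed.

(** The sum of the normals of the active constraints is minimized exactly where
    all of them are active, that is, only at the basic point. *)
Lemma basic_point_vertex x : basic_point x -> is_vertex polyhedron x.
Proof.
move=> [Px kerx].
pose c : 'rV[R]_d := \sum_(k | dotv (A k) x == b k) A k.
have dotc y : dotv c y = \sum_(k | dotv (A k) x == b k) dotv (A k) y.
  by rewrite dotvC dotv_sumr; apply: eq_bigr => k _; rewrite dotvC.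
pose beta := \sum_(k | dotv (A k) x == b k) b k.
exists c, beta; split=> [y Py|]; first by rewrite dotc ler_sum.
apply/seteqP; split=> [y [Py]|_ ->] /=; last first.
  by split=> //; rewrite dotc; apply: eq_bigr => k /eqP.
rewrite dotc => /eqP; rewrite -subr_eq0 -sumrB.
rewrite psumr_eq0 => [/allP tight|k _]; last by rewrite subr_ge0.
apply/eqP; rewrite -subr_eq0; apply/eqP/kerx => k xk.
have := tight k (mem_index_enum _); rewrite xk eqxx /= subr_eq0 => /eqP yk.
by rewrite dotvDr dotvNr yk xk subrr.
Qed.

(** If a direction u annihilated all active normals, x + t u and x - t u would
    both lie in the polyhedron for small t > 0; as a linear form that is
    minimal at their midpoint x takes its minimum at both, x would not be the
    only minimizer. *)
Lemma vertex_basic_point x : is_vertex polyhedron x -> basic_point x.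
Proof.
move=> [c [beta [cmin cface]]].
have [Px cx] : polyhedron x /\ dotv c x = beta.
  by have : [set x] x by []; rewrite -cface.
split=> // u tight0; apply/eqP/negPn/negP => u0.
(* f k is a step along u that constraint k allows both ways; the 1 in its
   denominator covers the constraints parallel to u. *)
have nearP : exists2 t, 0 < t &
    polyhedron (x + t *: u) /\ polyhedron (x - t *: u).
  pose f k := if dotv (A k) x == b k then 1 else
    (dotv (A k) x - b k) / (1 + `|dotv (A k) u|).
  have f0 k : 0 < f k.
    rewrite /f; case: eqP => // /eqP xk; apply: divr_gt0.
      by rewrite subr_gt0 lt_neqAle eq_sym xk Px.
    by rewrite ltr_pwDl.
  pose t := \big[Order.min/1]_k f k.
  have t0 : 0 < t.
    by apply: (big_ind (fun r => 0 < r)) => // r1 r2 r10 r20; rewrite lt_min r10.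
  exists t => //.
  have key k : t * `|dotv (A k) u| <= dotv (A k) x - b k.
    have [xk|xk] := eqVneq (dotv (A k) x) (b k).
      by rewrite tight0// normr0 mulr0 subr_ge0 Px.
    have : t <= f k by rewrite /t (bigD1 k)//= ge_min lexx.
    rewrite /f (negPf xk) ler_pdivlMr ?ltr_pwDl//.
    by apply: le_trans; rewrite ler_pM2l// lerDr.
  split=> k; have := key k; rewrite dotvDr ?dotvNr dotvZr.
    have : - (t * dotv (A k) u) <= t * `|dotv (A k) u|.
      by rewrite -mulrN ler_pM2l// ler_normr lexx orbT.
    lra.
  have : t * dotv (A k) u <= t * `|dotv (A k) u|.
    by rewrite ler_pM2l// ler_normr lexx.
  lra.
case: nearP => t t0 [/[dup] Pp /cmin cp /cmin].
rewrite dotvDr dotvNr dotvZr => cm.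
rewrite dotvDr dotvZr in cp.
have /eqP : x + t *: u = x.
  suff : [set x] (x + t *: u) by [].
  by rewrite -cface; split=> //; rewrite dotvDr dotvZr; lra.
by rewrite -subr_eq0 addrAC subrr add0r scaler_eq0 gt_eqF//= (negPf u0).
Qed.

End Polyhedron.

(** A basic point is the only solution of the linear system given by its active
    constraints. The system has rational coefficients and its rank does not
    depend on the field, so a rational matrix inverts it. *)
Lemma basic_point_rational (R : realType) d (T : finType)
    (A : T -> 'rV[rat]_d) (b : T -> rat) (x : 'rV[R]_d) :
  basic_point (fun k => map_mx ratr (A k)) (fun k => ratr (b k)) x ->
  exists y : 'rV[rat]_d, x = map_mx ratr y.
Proof.
move=> [_ kerx].
pose tight k := dotv (map_mx ratr (A k)) x == ratr (b k).
pose M : 'M[rat]_(d, #|T|) :=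
  \matrix_(i, j) (if tight (enum_val j) then A (enum_val j) 0 i else 0).
pose c : 'rV[rat]_#|T| :=
  \row_j (if tight (enum_val j) then b (enum_val j) else 0).
have mulM (u : 'rV[R]_d) j : (u *m map_mx ratr M) 0 j =
    if tight (enum_val j) then dotv (map_mx ratr (A (enum_val j))) u else 0.
  rewrite mxE; case: ifP => tj.
    by apply: eq_bigr => i _; rewrite !mxE tj mulrC.
  by rewrite big1// => i _; rewrite !mxE tj rmorph0 mulr0.
have xM : x *m map_mx ratr M = map_mx ratr c.
  apply/rowP => j; rewrite mulM !mxE.
  by case: ifP => [/eqP//|_]; rewrite rmorph0.
have : row_free M.
  rewrite -(row_free_map (@ratr R)) -kermx_eq0; apply/eqP/row_matrixP => i.
  rewrite row0; apply: kerx => k /eqP; rewrite -/(tight k) => tk.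
  have := mulM (row i (kermx (map_mx ratr M))) (enum_rank k).
  by rewrite enum_rankK tk -row_mul mulmx_ker row0 mxE.
case/row_freeP => B MB; exists (c *m B).
by rewrite map_mxM -xM -mulmxA -map_mxM MB map_mx1 mulmx1.
Qed.

(** * Monomial ideals and weights *)

Section NFold.
Local Open Scope classical_set_scope.
Variable s : nat.
Implicit Types (E : set 'X_{1..s}) (a e : 'X_{1..s}) (n k : nat).

(** Exponents of the products of n generators, when E is the set of exponents of
    the generators. *)
Fixpoint nfold E n : set 'X_{1..s} :=
  if n is n'.+1 then [set (e + a)%MM | e in E & a in nfold E n']
  else [set 0%MM].

Lemma nfoldD E n k a e :
  nfold E n a -> nfold E k e -> nfold E (n + k) (a + e)%MM.
Proof.
elim: n a => [_ ->|n IHn _ [x Ex [y Ey <-]]] Ee; first by rewrite add0m.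
by rewrite addSn -addmA; exists x => //; exists (y + e)%MM => //; apply: IHn.
Qed.

Lemma nfold_split E n k a : nfold E (n + k) a ->
  exists a1 a2, [/\ nfold E n a1, nfold E k a2 & a = (a1 + a2)%MM].
Proof.
elim: n a => [a Ea|n IHn _ [x Ex [y /IHn[a1 [a2 [E1 E2 ->]]] <-]]].
  by exists 0%MM, a; rewrite add0m.
exists (x + a1)%MM, a2; split=> //; last by rewrite addmA.
by exists x => //; exists a1.
Qed.

Lemma nfold_nfold E n k : nfold (nfold E n) k = nfold E (k * n).
Proof.
elim: k => [//|k IHk]; apply/seteqP; split=> [_ [x Ex [y Ey <-]]|a].
  by rewrite mulSn; apply: nfoldD => //; rewrite -IHk.
rewrite mulSn => /nfold_split[x [y [Ex Ey ->]]].
by exists x => //; exists y => //; rewrite IHk.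
Qed.

Lemma nfold_muln E n e : E e -> nfold E n (e *+ n)%MM.
Proof.
move=> Ee; elim: n => [//|n IHn]; rewrite mulmS.
by exists e => //; exists (e *+ n)%MM.
Qed.

Lemma nfold_sum E (T : finType) (e : T -> 'X_{1..s}) (c : T -> nat) :
  (forall i, (0 < c i)%N -> E (e i)) ->
  nfold E (\sum_i c i) (\big[+%MM/0%MM]_i (e i *+ c i)%MM).
Proof.
move=> Ee; apply: (big_ind2 (nfold E)) => // [n a k b|i _]; first exact: nfoldD.
by case: (posnP (c i)) => [->|/Ee]; [|exact: nfold_muln].
Qed.

End NFold.

Section MonomialIdeals.
Local Open Scope classical_set_scope.
Variables (K : fieldType) (s : nat).
Local Notation S := {mpoly K[s]}.
Local Notation mono_ideal := (@mono_ideal K s).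
Implicit Types (E F U : set 'X_{1..s}) (a b e : 'X_{1..s}) (f g : S).

Definition supported_in U : set S := [set f | forall a, a \in msupp f -> U a].

Lemma supported_in_ideal U :
  (forall a b, U a -> U (b + a)%MM) -> is_ideal (supported_in U).
Proof.
move=> Uup; split=> [a|f g fU gU a|g f fU a]; first by rewrite msupp0.
  by move=> /msuppD_le; rewrite mem_cat => /orP[/fU|/gU].
by move=> /msuppM_le/allpairsP[[b c] /= [_ cf ->]]; apply/Uup/fU.
Qed.

(** Sums and multiples only involve monomials divisible by those at hand, so the
    right-hand side is an ideal. *)
Lemma mono_idealE E :
  mono_ideal E = supported_in [set a | exists2 e, E e & (e <= a)%MM].
Proof.
apply/seteqP; split=> [|f fE].
  apply: ideal_gen_sub => [|_ [e Ee <-] a].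
    apply: supported_in_ideal => a b [e Ee lea]; exists e => //.
    exact: lepm_trans lea (lem_addl _ _).
  by rewrite msuppX inE => /eqP ->; exists e => //; apply: lepm_refl.
rewrite [f]mpolyE; apply: is_ideal_sum => [|a /fE[e Ee lea]].
  exact: ideal_gen_is_ideal.
rewrite -(submK lea) mpolyXD scalerAl.
have [_ _] := ideal_gen_is_ideal [set ('X_[a] : S) | a in E].
by apply; apply: sub_ideal_gen; exists e.
Qed.

Lemma mono_idealX E a :
  mono_ideal E 'X_[a] <-> exists2 e, E e & (e <= a)%MM.
Proof.
rewrite mono_idealE; split=> [|Ea b]; first by apply; rewrite msuppX inE.
by rewrite msuppX inE => /eqP ->.
Qed.

Lemma mono_ideal_msupp E f : mono_ideal E f <->
  forall a, a \in msupp f -> mono_ideal E 'X_[a].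
Proof. by rewrite {1}mono_idealE; split=> Ef a /Ef /mono_idealX. Qed.

Lemma mono_ideal_mul E F :
  ideal_mul (mono_ideal E) (mono_ideal F) =
  mono_ideal [set (e + a)%MM | e in E & a in F].
Proof.
apply/seteqP; split; apply: ideal_gen_sub; do ?exact: ideal_gen_is_ideal.
  move=> _ [f [g [+ + ->]]]; rewrite !mono_idealE => fE gF a.
  move=> /msuppM_le/allpairsP[[b c] /= [/fE[x Ex xb] /gF[y Fy yc] ->]].
  exists (x + y)%MM; first by exists x => //; exists y.
  by apply/mnm_lepP => i; rewrite !mnmDE leq_add//; apply/mnm_lepP.
move=> _ [_ [e Ee [a Fa <-]] <-]; rewrite mpolyXD.
apply: sub_ideal_gen; exists 'X_[e], 'X_[a]; split=> //; apply/mono_idealX.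
  by exists e => //; apply: lepm_refl.
by exists a => //; apply: lepm_refl.
Qed.

Lemma mono_ideal_pow E n : ideal_pow (mono_ideal E) n = mono_ideal (nfold E n).
Proof.
elim: n => [|n IHn] /=; last by rewrite IHn mono_ideal_mul.
rewrite mono_idealE; apply/seteqP; split=> // f _ a _.
by exists 0%MM => //; apply/mnm_lepP => i; rewrite mnm0E.
Qed.

Lemma irr_ideal_mono b :
  irr_ideal K b =
  mono_ideal [set (U_(i) *+ b i)%MM | i in [set i | (1 <= b i)%N]].
Proof.
rewrite /irr_ideal /mono_ideal image_comp; congr ideal_gen.
by apply: eq_imagel => i _; rewrite /= mpolyXn.
Qed.

Lemma irr_idealX b a : irr_ideal K b 'X_[a] <-> exists j, (1 <= b j <= a j)%N.
Proof.
have le_mul i : (U_(i) *+ b i <= a)%MM = (b i <= a i)%N.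
  apply/mnm_lepP/idP => [/(_ i)|bi j]; first by rewrite mulmnE mnm1E eqxx mul1n.
  by rewrite mulmnE mnm1E; case: eqP => [<-|]; rewrite ?mul1n.
rewrite irr_ideal_mono mono_idealX; split=> [[_ [i bi <-]]|[i /andP[bi ai]]].
  by rewrite le_mul => ai; exists i; apply/andP.
by exists (U_(i) *+ b i)%MM; [exists i|rewrite le_mul].
Qed.

Lemma irr_ideal_msupp b f : irr_ideal K b f <->
  forall a, a \in msupp f -> irr_ideal K b 'X_[a].
Proof. by rewrite irr_ideal_mono; apply: mono_ideal_msupp. Qed.

Lemma mono_ideal_pow_msupp E n f : ideal_pow (mono_ideal E) n f <->
  forall a, a \in msupp f -> ideal_pow (mono_ideal E) n 'X_[a].
Proof. by rewrite mono_ideal_pow; apply: mono_ideal_msupp. Qed.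

(** The product of the powers (t_i ^ b_i) ^ (c_i) is a product of at least n
    generators dividing t ^ a. *)
Lemma irr_ideal_pow_mem b n (c : 'I_s -> nat) a :
    (forall i, (0 < c i)%N -> (0 < b i)%N) ->
    (forall i, c i * b i <= a i)%N -> (n <= \sum_i c i)%N ->
  ideal_pow (irr_ideal K b) n 'X_[a].
Proof.
move=> cb cba nc; rewrite irr_ideal_mono mono_ideal_pow; apply/mono_idealX.
set E := [set _ | _ in _].
have : nfold E (\sum_i c i) (\big[+%MM/0%MM]_i (U_(i) *+ b i *+ c i)%MM).
  by apply: nfold_sum => i /cb bi; exists i.
rewrite -(subnKC nc) => /nfold_split[a1 [a2 [E1 _ eqa]]].
exists a1 => //; apply: lepm_trans (lem_addr _ a2) _; rewrite -eqa.
apply/mnm_lepP => i; rewrite mnm_sumE (bigD1 i)//= big1 => [|j ji].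
  by rewrite !mulmnE mnm1E eqxx mul1n addn0 mulnC.
by rewrite !mulmnE mnm1E (negPf ji) !mul0n.
Qed.

Section Weight.
Variable w : 'I_s -> nat.

Definition weight a : nat := \sum_i a i * w i.

Lemma weightD a b : weight (a + b)%MM = (weight a + weight b)%N.
Proof. by rewrite -big_split; apply: eq_bigr => i _; rewrite mnmDE mulnDl. Qed.

Lemma weight_le a b : (a <= b)%MM -> (weight a <= weight b)%N.
Proof.
by move=> /mnm_lepP ab; apply: leq_sum => i _; rewrite leq_mul2r ab orbT.
Qed.

Definition weight_ge n : set S := supported_in [set a | n <= weight a]%N.

Lemma weight_ge_ideal n : is_ideal (weight_ge n).
Proof.
apply: supported_in_ideal => a b /= na.
by rewrite weightD (leq_trans na)// leq_addl.
Qed.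

Lemma nfold_weight E n k a : (forall e, E e -> (n <= weight e)%N) ->
  nfold E k a -> (k * n <= weight a)%N.
Proof.
move=> En; elim: k a => [//|k IHk _ [x Ex [y Ey <-]]].
by rewrite weightD mulSn leq_add// ?En// IHk.
Qed.

Lemma mcoeff_restrict (P : pred 'X_{1..s}) f a :
  (\sum_(m <- msupp f | P m) f@_m *: 'X_[m])@_a = if P a then f@_a else 0.
Proof.
rewrite raddf_sum big_mkcond /=.
have [af|af] := boolP (a \in msupp f).
  rewrite (bigD1_seq a)//= big1 ?addr0 => [|m ma].
    by rewrite mcoeffZ mcoeffX eqxx mulr1.
  by rewrite mcoeffZ mcoeffX (negPf ma) mulr0; case: ifP.
rewrite (memN_msupp_eq0 af) if_same big_seq big1 // => m mf.
rewrite mcoeffZ mcoeffX; case: eqP => [ma|_]; last by rewrite mulr0; case: ifP.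
by move: af; rewrite -ma mf.
Qed.

(** Together with [min_weight_mul], this makes the least weight of a monomial a
    valuation. *)
Lemma exists_min_weight f : f != 0 ->
  exists2 a, a \in msupp f & weight_ge (weight a) f.
Proof.
move=> f0.
have ex : exists n, has (fun a => weight a == n) (msupp f).
  exists (weight (mlead f)); apply/hasP; exists (mlead f) => //.
  exact: mlead_supp.
case: (ex_minnP ex) => n /hasP[a af /eqP an] nmin; exists a => // b bf /=.
by rewrite an; apply: nmin; apply/hasP; exists b.
Qed.

(** The product of the initial forms (the parts of least weight) of f and g is
    nonzero because polynomials over a field form a domain, and no other
    products of monomials of f and g contribute to its monomials. *)
Lemma min_weight_mul f g a b : a \in msupp f -> b \in msupp g ->
    weight_ge (weight a) f -> weight_ge (weight b) g ->
  exists2 c, c \in msupp (f * g) & weight c = (weight a + weight b)%N.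
Proof.
move=> af bg fmin gmin.
pose init (h : S) n := \sum_(m <- msupp h | weight m == n) h@_m *: 'X_[m].
have initN0 h m : m \in msupp h -> init h (weight m) != 0.
  move=> mh; apply: contraTneq mh => /(congr1 (mcoeff m)).
  by rewrite mcoeff_restrict eqxx mcoeff0 mcoeff_msupp => ->; rewrite eqxx.
have init_weight h n m : m \in msupp (init h n) -> weight m = n.
  rewrite mcoeff_msupp mcoeff_restrict; case: ifP => [/eqP //|].
  by rewrite eqxx.
set f1 := init f (weight a); set g1 := init g (weight b).
have fg1 : f1 * g1 != 0 by rewrite mulf_neq0 ?initN0.
pose c := mlead (f1 * g1).
have c1 : c \in msupp (f1 * g1) by apply: mlead_supp.
have wc : weight c = (weight a + weight b)%N.
  have /msuppM_le/allpairsP[[x y] /=] := c1.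
  move=> [/init_weight <- /init_weight <- ->].
  by rewrite weightD.
exists c => //; move: c1; rewrite !mcoeff_msupp; congr (_ != 0).
rewrite !mcoeffM; apply: eq_bigr => -[x y] /= /eqP cxy.
rewrite !mcoeff_restrict.
have [xf|/memN_msupp_eq0 ->] := boolP (bmnm x \in msupp f); last first.
  by case: ifP => _; rewrite ?mul0r.
have [yg|/memN_msupp_eq0 ->] := boolP (bmnm y \in msupp g); last first.
  by case: (weight y == _); rewrite !mulr0.
have wxy : (weight x + weight y = weight a + weight b)%N.
  by rewrite -weightD -cxy.
have /= [wx wy] := (fmin _ xf, gmin _ yg).
have -> : weight x = weight a.
  apply/eqP; rewrite eqn_leq wx andbT -(leq_add2r (weight b)) -wxy.
  by rewrite leq_add2l.
have -> : weight y = weight b.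
  apply/eqP; rewrite eqn_leq wy andbT -(leq_add2l (weight a)) -wxy.
  by rewrite leq_add2r.
by rewrite !eqxx.
Qed.

(** These ideals are primary: a factor with a monomial of weight 0 does not
    change the least weight. *)
Lemma weight_ge_cancel n f g :
  ~ weight_ge 1 g -> weight_ge n (g * f) -> weight_ge n f.
Proof.
move=> g1 gfn; have [->|f0] := eqVneq f 0.
  by case: (weight_ge_ideal n).
have g0 : g != 0.
  by apply/negP => /eqP g0; apply: g1; rewrite g0; case: (weight_ge_ideal 1).
have [a af amin] := exists_min_weight f0.
have [b bg bmin] := exists_min_weight g0.
have wb : weight b = 0%N.
  case: (posnP (weight b)) => // b1; case: g1 => c cg /=.
  exact: leq_trans b1 (bmin c cg).
have [c cgf wc] := min_weight_mul bg af bmin amin.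
move=> d /amin /=; apply: leq_trans.
by have := gfn c cgf; rewrite /= wc wb.
Qed.

Lemma weight_ge1_prime : prime_ideal (weight_ge 1).
Proof.
split; first exact: weight_ge_ideal.
  move=> /(_ 0%MM); rewrite msupp1 inE eqxx => /(_ isT) /=.
  by rewrite /weight big1// => i _; rewrite mnm0E.
move=> f g fg; have [|nf] := pselect (weight_ge 1 f); first by left.
by right; apply: weight_ge_cancel nf fg.
Qed.

Lemma weight_ge_exp f k : weight_ge 1 f -> weight_ge k (f ^+ k).
Proof.
move=> f1; elim: k => [|k IHk] a; first by [].
rewrite exprS => /msuppM_le/allpairsP[[x y] /= [/f1 /= x1 /IHk /= yk ->]].
by rewrite weightD -add1n leq_add.
Qed.

End Weight.

(** When truncating exponents at a fixed bound preserves U, the finitely many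
    exponents below the bound generate. For an intersection of irreducible
    ideals, the sum of their exponents is such a bound. *)
Lemma finite_mono_generators U (bound : 'X_{1..s}) :
    (forall a, U a -> U [multinom minn (a j) (bound j) | j < s]) ->
  exists q (v : 'I_q -> 'X_{1..s}), mono_ideal U = mono_ideal (range v).
Proof.
move=> Ubound.
pose F := [set a : 'X_{1..s < (mdeg bound).+1} | `[< U a >]]%SET.
exists #|F|, (fun j => bmnm (enum_val j)).
rewrite !mono_idealE; apply/seteqP; split=> f fU a /fU[e Ue lea]; last first.
  case: Ue lea => j _ <- lea; exists (bmnm (enum_val j)) => //.
  by have := enum_valP j; rewrite inE => /asboolP.
pose c := [multinom minn (e j) (bound j) | j < s].
have cdeg : (mdeg c < (mdeg bound).+1)%N.
  by rewrite ltnS !mdegE; apply: leq_sum => j _; rewrite mnmE geq_minr.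
have cF : BMultinom cdeg \in F by rewrite inE; apply/asboolP/Ubound.
exists c.
  by exists (enum_rank_in cF (BMultinom cdeg)); rewrite ?enum_rankK_in.
apply: lepm_trans lea; apply/mnm_lepP => j.
by rewrite mnmE geq_minl.
Qed.

(** A redundant generator can be dropped, and the number of generators falls. *)
Lemma exists_minimal_generators q (v : 'I_q -> 'X_{1..s}) :
  exists q' (v' : 'I_q' -> 'X_{1..s}),
    minimally_generated (mono_ideal (range v)) v'.
Proof.
elim: q v => [|q IHq] v; first by exists 0%N, v; split=> // -[].
have [minv|/existsNP[j /contrapT eqI]] := pselect (forall j,
  mono_ideal (range v) <> mono_ideal [set v i | i in [set i | i != j]]).
  by exists q.+1, v.
suff -> : mono_ideal (range v) = mono_ideal (range (v \o lift j)) by exact: IHq.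
rewrite eqI; congr mono_ideal; apply/seteqP.
split=> [_ [i /= ij <-]|_ [i _ <-]].
  have [k ->|eqij] := unliftP j i; first by exists k.
  by rewrite eqij eqxx in ij.
by exists (lift j i) => //=; rewrite eq_sym neq_lift.
Qed.

End MonomialIdeals.

(** * Irreducible monomial ideals, minimal primes and symbolic powers *)

Section PrimeIdeals.
Local Open Scope classical_set_scope.
Variable A : comNzRingType.
Implicit Types (P I J : set A) (x h : A).

Lemma prime_ideal_exp P x k : prime_ideal P -> P (x ^+ k) -> P x.
Proof.
move=> [_ P1 PM]; elim: k => [//|k IHk].
by rewrite exprS => /PM[].
Qed.

Lemma prime_ideal_prod P (T : finType) (F : T -> A) :
  prime_ideal P -> P (\prod_i F i) -> exists i, P (F i).
Proof.
move=> [_ P1 PM] PF; apply: contrapT => /forallNP nF.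
suff : ~ P (\prod_i F i) by [].
apply: (big_ind (fun x => ~ P x)) => // x y nx ny.
by move=> /PM[].
Qed.

(** When h becomes a unit in a localization, this compares the localized powers
    of I and J. *)
Lemma ideal_pow_colon I J h n x : (forall y, J y -> I (h * y)) ->
  ideal_pow J n x -> ideal_pow I n (h ^+ n * x).
Proof.
move=> hJ; elim: n x => [//|n IHn] x.
move: x; apply: ideal_gen_sub => [|_ [a [b [Ja Jb ->]]]]; last first.
  by rewrite exprS mulrACA; apply: ideal_powS_mem; [apply: hJ|apply: IHn].
have [I0 ID IM] := ideal_pow_is_ideal I n.+1.
split=> [|a b Ia Ib|a b Ib]; first by rewrite mulr0.
  by rewrite mulrDr; apply: ID.
by rewrite mulrCA; apply: IM.
Qed.

End PrimeIdeals.

Section IrreducibleMonomialIdeals.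
Local Open Scope classical_set_scope.
Variables (K : fieldType) (s : nat).
Local Notation S := {mpoly K[s]}.
Local Notation mono_ideal := (@mono_ideal K s).
Local Notation irr_ideal := (@irr_ideal K s).
Implicit Types (E : set 'X_{1..s}) (a b : 'X_{1..s}) (f g : S) (n k : nat).

Lemma irr_ideal_is_ideal b : is_ideal (irr_ideal b).
Proof. exact: ideal_gen_is_ideal. Qed.

Lemma mono_ideal_pow_pow E n k :
  ideal_pow (ideal_pow (mono_ideal E) n) k = ideal_pow (mono_ideal E) (k * n).
Proof. by rewrite !mono_ideal_pow nfold_nfold. Qed.

(** In an equation of integral dependence of degree d for t ^ a, the monomial
    t ^ (d a) has to cancel against a term c_i t ^ ((d - i) a); so t ^ (i a)
    is a monomial of c_i, an element of the i-th power of the ideal. *)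
Lemma integral_closure_mono_pow E n a :
    integral_closure (ideal_pow (mono_ideal E) n) 'X_[a] ->
  exists2 i, (1 <= i)%N & exists2 e, nfold E (i * n) e & (e <= a *+ i)%MM.
Proof.
move=> [d [c [d0 Jc eq0]]].
have [i /andP[i0 id] ci] : exists2 i, (1 <= i <= d)%N & (c i)@_(a *+ i)%MM != 0.
  apply: contrapT => no; move/(congr1 (mcoeff (a *+ d)%MM)): eq0.
  rewrite mcoeff0 mcoeffD mpolyXn mcoeffX eqxx raddf_sum /= big_nat_cond.
  rewrite big1 ?addr0 => [/eqP|i /andP[/andP[i0 id] _]].
    by rewrite oner_eq0.
  have -> : (a *+ d = a *+ (d - i) + a *+ i)%MM.
    by apply/mnmP => j; rewrite mnmDE !mulmnE -mulnDr subnK.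
  rewrite mpolyXn mcoeffMX; apply/eqP/negPn/negP => ci; apply: no.
  by exists i; rewrite ?i0.
exists i => //; have := Jc i; rewrite i0 => /(_ id).
rewrite mono_ideal_pow_pow mono_ideal_pow mono_idealE.
by apply; rewrite mcoeff_msupp.
Qed.

(** A positive integer such that [scale b] times the inverse vector of b is
    integral; this product is [scaled_inv b]. It makes the pairing with the
    inverse vector a weight with values in the naturals. *)
Definition scale b : nat := \prod_j maxn 1 (b j).

Definition scaled_inv b (j : 'I_s) : nat :=
  if (1 <= b j)%N then (scale b %/ b j)%N else 0%N.

(** The indicator vector of the support of b; the associated weight counts the
    degree in the variables of the radical of the irreducible ideal of b. *)
Definition mem_supp b (j : 'I_s) : nat := (1 <= b j)%N.

Lemma scale_gt0 b : (0 < scale b)%N.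
Proof. by apply: prodn_gt0 => j; rewrite leq_max. Qed.

Lemma scaled_invK b j : (1 <= b j)%N -> (scaled_inv b j * b j = scale b)%N.
Proof.
move=> bj; rewrite /scaled_inv bj divnK// /scale (bigD1 j)//=.
by rewrite (maxn_idPr bj) dvdn_mulr.
Qed.

Lemma irr_ideal_pow_weight b n a : ideal_pow (irr_ideal b) n 'X_[a] ->
  (n * scale b <= weight (scaled_inv b) a)%N.
Proof.
rewrite irr_ideal_mono mono_ideal_pow => /mono_idealX[e En lea].
apply: leq_trans (weight_le _ lea); apply: nfold_weight En => _ [i bi <-].
rewrite /weight (bigD1 i)//= mulmnE mnm1E eqxx mul1n mulnC scaled_invK//.
exact: leq_addr.
Qed.

(** The integral closure of q ^ n contains every t ^ a with <a, b^-1> >= n: the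
    power with exponent k = [scale b] is divisible by the product of the
    (t_i ^ b_i) ^ (a_i k / b_i), which has k <a, b^-1> factors. Normality puts
    t ^ a itself in q ^ n. *)
Lemma normal_irr_ideal_powX b n a : normal_ideal (irr_ideal b) -> (1 <= n)%N ->
  ideal_pow (irr_ideal b) n 'X_[a] <->
  (n * scale b <= weight (scaled_inv b) a)%N.
Proof.
move=> normb n0; split=> [|an]; first exact: irr_ideal_pow_weight.
rewrite normb//; apply: integral_closure_root (scale_gt0 b) _.
rewrite irr_ideal_mono mono_ideal_pow_pow -irr_ideal_mono mpolyXn.
apply: (@irr_ideal_pow_mem K s b _ (fun i => a i * scaled_inv b i)%N).
- by move=> i; rewrite /scaled_inv; case: ifP => //; rewrite muln0.
- move=> i; rewrite mulmnE -mulnA; have [bi|bi] := ltnP 0 (b i).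
    by rewrite scaled_invK.
  by move: bi; rewrite leqn0 => /eqP ->; rewrite !muln0.
- by rewrite mulnC.
Qed.

Lemma normal_irr_ideal_pow b n : normal_ideal (irr_ideal b) -> (1 <= n)%N ->
  ideal_pow (irr_ideal b) n = @weight_ge K s (scaled_inv b) (n * scale b)%N.
Proof.
move=> normb n0; apply/seteqP; split=> f.
  move=> + a af; rewrite irr_ideal_mono => /mono_ideal_pow_msupp/(_ _ af).
  by rewrite -irr_ideal_mono => /irr_ideal_pow_weight.
move=> fn; rewrite irr_ideal_mono; apply/mono_ideal_pow_msupp => a af.
by rewrite -irr_ideal_mono; apply/normal_irr_ideal_powX => //; apply: fn.
Qed.

(** The prime generated by the variables occurring in b, as the polynomials all
    of whose monomials contain such a variable. *)
Definition irr_radical b : set S := weight_ge (mem_supp b) 1.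

Lemma irr_radical_prime b : prime_ideal (irr_radical b).
Proof. exact: weight_ge1_prime. Qed.

Lemma weight_mem_supp_gt0 b a :
  (0 < weight (mem_supp b) a)%N <-> exists j, (1 <= b j)%N && (1 <= a j)%N.
Proof.
rewrite lt0n sum_nat_eq0 negb_forall; split=> [/existsP[j]|[j /andP[bj aj]]].
  by rewrite muln_eq0 negb_or -!lt0n lt0b => /andP[aj bj]; exists j; apply/andP.
by apply/existsP; exists j; rewrite muln_eq0 negb_or -!lt0n lt0b aj.
Qed.

Lemma irr_ideal_sub_radical b : irr_ideal b `<=` irr_radical b.
Proof.
move=> f /irr_ideal_msupp fb a /fb/irr_idealX[j /andP[bj ba]].
by apply/weight_mem_supp_gt0; exists j; rewrite bj (leq_trans bj).
Qed.

(** A monomial of degree more than the sum of the b_j in the variables of b has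
    some exponent at least b_j. *)
Lemma irr_radical_exp b f : irr_radical b f -> irr_ideal b (f ^+ (mdeg b).+1).
Proof.
move=> fb; apply/irr_ideal_msupp => a /(weight_ge_exp fb) /=.
move=> ab; apply/irr_idealX; apply: contrapT => /forallNP no.
move: ab; rewrite ltnNge mdegE => /negP; apply; apply: leq_sum => j _.
rewrite /mem_supp; have [bj|_] := ltnP 0 (b j); last by rewrite muln0.
rewrite muln1 ltnW// ltnNge; apply/negP => ba.
by apply: (no j); rewrite bj.
Qed.

Lemma radical_irr_ideal b : radical (irr_ideal b) = irr_radical b.
Proof.
apply/seteqP; split=> f => [[k k0 /irr_ideal_sub_radical]|/irr_radical_exp fk].
  exact: (prime_ideal_exp (irr_radical_prime b)).
by exists (mdeg b).+1.
Qed.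

Section Decomposition.
Variables (I : set S) (m : nat) (alpha : 'I_m -> 'X_{1..s}).
Hypothesis decI : irreducible_decomposition I alpha.

Lemma mem_decP f : I f <-> forall i, irr_ideal (alpha i) f.
Proof.
by case: decI => _ -> _; split=> [If i|If i _]; apply: If.
Qed.

Lemma dec_msupp f : I f <-> forall a, a \in msupp f -> I 'X_[a].
Proof.
split=> [/mem_decP fI a af|fI]; apply/mem_decP => i; last first.
  by apply/irr_ideal_msupp => a /fI/mem_decP.
by move/irr_ideal_msupp: (fI i); apply.
Qed.

Definition exponents : set 'X_{1..s} := [set a | I 'X_[a]].

Lemma exponents_up a b : (a <= b)%MM -> I 'X_[a] -> I 'X_[b].
Proof.
move=> /mnm_lepP ab /mem_decP aI.
apply/mem_decP => i; apply/irr_idealX.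
have [j /andP[ij aj]] := (iffLR (irr_idealX _ _ _)) (aI i).
by exists j; rewrite ij (leq_trans aj).
Qed.

Lemma dec_mono : I = mono_ideal exponents.
Proof.
rewrite mono_idealE; apply/seteqP; split=> f.
  by move=> /dec_msupp fI a /fI aI; exists a => //; apply: lepm_refl.
by move=> fI; apply/dec_msupp => a /fI[e eI /exponents_up]; apply.
Qed.

Lemma dec_generators :
  exists q (v : 'I_q -> 'X_{1..s}), minimally_generated I v.
Proof.
pose bound := [multinom (\sum_i alpha i j)%N | j < s].
have [|q [v eqv]] := @finite_mono_generators K s exponents bound.
  move=> a /mem_decP aI; apply/mem_decP => i; apply/irr_idealX.
  have [j /andP[ij aj]] := (iffLR (irr_idealX _ _ _)) (aI i).
  exists j; rewrite ij mnmE leq_min aj mnmE.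
  by rewrite (bigD1 i)//= leq_addr.
by rewrite dec_mono eqv; apply: exists_minimal_generators.
Qed.

Lemma dec_sub_radical i : I `<=` irr_radical (alpha i).
Proof. by move=> f /mem_decP/(_ i)/irr_ideal_sub_radical. Qed.

(** A prime containing the intersection contains one of the irreducible
    components, otherwise it would contain a product of elements outside it. *)
Lemma minimal_prime_irr_radical P :
  minimal_prime I P -> exists i, P = irr_radical (alpha i).
Proof.
move=> [primP IP minP].
have [i iP] : exists i, irr_ideal (alpha i) `<=` P.
  apply: contrapT => /forallNP no.
  have /fin_all_exists2[f fI fP] :
      forall i, exists2 f, irr_ideal (alpha i) f & ~ P f.
    move=> i; apply: contrapT => nof; apply: (no i) => f fi.
    by apply: contrapT => fP; apply: nof; exists f.
  have Iprod : I (\prod_i f i).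
    apply/mem_decP => i; rewrite (bigD1 i)//=.
    exact: ideal_mulr (irr_ideal_is_ideal _) (fI i).
  have [i Pi] := prime_ideal_prod primP (IP _ Iprod).
  exact: fP Pi.
exists i; apply/esym/minP; [exact: irr_radical_prime|exact: dec_sub_radical|].
by move=> f /irr_radical_exp/iP/(prime_ideal_exp primP).
Qed.

(** Irredundance gives a monomial t ^ b in all components but the i-th. Raising
    its exponent at each variable of the i-th component to one less than the
    generator keeps it outside that component, while one more factor from the
    radical brings it in: its annihilator modulo I is the radical. *)
Lemma irr_radical_associated i : associated_prime I (irr_radical (alpha i)).
Proof.
split; first exact: irr_radical_prime.
have [f fj nfi] : exists2 f, (forall j, j != i -> irr_ideal (alpha j) f) &
    ~ irr_ideal (alpha i) f.
  apply: contrapT => no; case: decI => _ _ /(_ i); apply.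
  apply/seteqP; split=> f fI => [j _|]; first by move/mem_decP: fI; apply.
  apply/mem_decP => j; have [->|ji] := eqVneq j i; last exact: fI.
  by apply: contrapT => nfi; apply: no; exists f => // k; apply: fI.
have [b bf nbi] : exists2 b, b \in msupp f & ~ irr_ideal (alpha i) 'X_[b].
  apply: contrapT => no; apply: nfi; apply/irr_ideal_msupp => b bf.
  by apply: contrapT => nb; apply: no; exists b.
have blt j : (1 <= alpha i j)%N -> (b j < alpha i j)%N.
  move=> ij; rewrite ltnNge; apply/negP => jb.
  by apply: nbi; apply/irr_idealX; exists j; rewrite ij.
pose h :=
  [multinom (if (1 <= alpha i j)%N then (alpha i j).-1 else b j) | j < s].
exists 'X_[h]; apply/seteqP; split=> g gI; last first.
  move=> a ag; apply/weight_mem_supp_gt0.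
  have /mem_decP/(_ i)/irr_idealX[j /andP[ij]] : I 'X_[h + a].
    by move/dec_msupp: gI; apply; rewrite mcoeff_msupp mcoeffMX -mcoeff_msupp.
  rewrite mnmDE mnmE ij => aj; exists j.
  by rewrite ij /= -(ltn_add2l (alpha i j).-1) addn0 prednK.
apply/dec_msupp => x /msuppM_le/allpairsP[[a c] /= [/gI ag]].
rewrite msuppX inE => /eqP -> ->; apply/mem_decP => j; apply/irr_idealX.
have [->|ji] := eqVneq j i.
  have /weight_mem_supp_gt0[l /andP[il al]] := ag.
  by exists l; rewrite il mnmDE mnmE il -(prednK il) -add1n leq_add.
have /irr_idealX[l /andP[jl bl]] : irr_ideal (alpha j) 'X_[b].
  by move/irr_ideal_msupp: (fj _ ji); apply.
exists l; rewrite jl mnmDE mnmE (leq_trans bl)// (leq_trans _ (leq_addl _ _))//.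
by case: ifP => // il; rewrite -ltnS prednK// blt.
Qed.

Hypothesis no_emb : no_embedded_primes I.
Hypothesis rad_neq : forall i j : 'I_m, j <> i ->
  radical (irr_ideal (alpha j)) <> radical (irr_ideal (alpha i)).

Lemma irr_radical_minimal i : minimal_prime I (irr_radical (alpha i)).
Proof. exact/no_emb/irr_radical_associated. Qed.

Lemma supports_incomparable i j : j != i ->
  exists l, (1 <= alpha j l)%N && (alpha i l == 0%N).
Proof.
move=> /eqP ji; apply: contrapT => /forallNP no.
apply: (rad_neq ji); rewrite !radical_irr_ideal.
have [_ _] := irr_radical_minimal i; apply.
- exact: irr_radical_prime.
- exact: dec_sub_radical.
move=> f fj a /fj /weight_mem_supp_gt0[l /andP[jl al]].
apply/weight_mem_supp_gt0; exists l; rewrite al andbT lt0n.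
by apply/negP => il; apply: (no l); rewrite jl.
Qed.

(** The product of high powers of all variables outside the support of the i-th
    component. It is a unit at the i-th prime, and lies in every other
    component since the supports are incomparable. *)
Lemma exists_separating_element i :
  exists2 h, ~ irr_radical (alpha i) h &
    forall f, irr_ideal (alpha i) f -> I (h * f).
Proof.
pose h := [multinom (if alpha i l == 0 then \sum_j alpha j l else 0)%N | l < s].
exists 'X_[h].
  move=> /(_ h); rewrite msuppX inE eqxx => /(_ isT)/weight_mem_supp_gt0[l].
  by rewrite mnmE; case: eqP => [->|]; rewrite ?andbF.
move=> f fi; apply/mem_decP => j; have [->|ji] := eqVneq j i.
  by have [_ _] := irr_ideal_is_ideal (alpha i); apply.
apply: (ideal_mulr _ (irr_ideal_is_ideal _)).
have [l /andP[jl il]] := supports_incomparable ji.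
by apply/irr_idealX; exists l; rewrite jl mnmE il (bigD1 j)//= leq_addr.
Qed.

(** I and its i-th component agree after localizing at the i-th prime. *)
Lemma irr_pow_sub_symbolic n f :
  (forall i, ideal_pow (irr_ideal (alpha i)) n f) -> symbolic_power I n f.
Proof.
move=> fn P /minimal_prime_irr_radical[i ->].
have [h hi hI] := exists_separating_element i.
exists (h ^+ n * f), (h ^+ n); split.
- exact: ideal_pow_colon hI (fn i).
- by move=> /(prime_ideal_exp (irr_radical_prime _)).
- rewrite rmorphM mulrAC divff ?mul1r// tofrac_eq0.
  apply/expf_neq0/negP => /eqP h0; apply: hi; rewrite h0.
  by have [[]] := irr_radical_prime (alpha i).
Qed.

Hypothesis normal_q : forall i, normal_ideal (irr_ideal (alpha i)).

(** The powers of a normal irreducible ideal are given by a weight, hence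
    primary, so denominators outside the prime can be cancelled. *)
Lemma symbolic_sub_irr_pow n f : (1 <= n)%N -> symbolic_power I n f ->
  forall i, ideal_pow (irr_ideal (alpha i)) n f.
Proof.
move=> n0 fI i; have [a [g [aI gi /eqP]]] := fI _ (irr_radical_minimal i).
have g0 : tofrac g != 0.
  rewrite tofrac_eq0; apply/negP => /eqP g0; apply: gi; rewrite g0.
  by have [[]] := irr_radical_prime (alpha i).
rewrite -(inj_eq (mulIf g0)) divfK// -rmorphM tofrac_eq => /eqP fg.
rewrite normal_irr_ideal_pow//.
have ngi : ~ weight_ge (scaled_inv (alpha i)) 1 g.
  move=> gw; apply: gi => c /gw /=; apply: contraTT.
  rewrite -!leqNgt !leqn0 /weight !sum_nat_eq0 => /forallP c0.
  apply/forallP => j; move: (c0 j); rewrite !muln_eq0 => /orP[->//|].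
  by rewrite /mem_supp /scaled_inv; case: ltnP; rewrite ?eqxx ?orbT.
apply: weight_ge_cancel ngi _; rewrite mulrC fg -normal_irr_ideal_pow//.
apply: ideal_pow_mono aI => x /mem_decP; exact.
Qed.

Lemma symbolic_powerE n f : (1 <= n)%N ->
  symbolic_power I n f <-> forall i, ideal_pow (irr_ideal (alpha i)) n f.
Proof.
by move=> n0; split; [exact: symbolic_sub_irr_pow|exact: irr_pow_sub_symbolic].
Qed.

End Decomposition.

End IrreducibleMonomialIdeals.

(** * Exponents as points of the Newton polyhedron *)

Section RationalVectors.
Variable (d : nat).

Lemma common_denominator (y : 'rV[rat]_d) : (forall i, 0 <= y 0 i) ->
  exists2 N, (1 <= N)%N &
    exists a : 'I_d -> nat, forall i, N%:R * y 0 i = (a i)%:R.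
Proof.
move=> y0; pose D i := absz (denq (y 0 i)).
have D0 i : (0 < D i)%N by rewrite absz_gt0 denq_neq0.
exists (\prod_i D i)%N; first exact: prodn_gt0.
(* the numerator of y i over the product of all denominators *)
exists (fun i => absz (numq (y 0%R i)) * \prod_(j | j != i) D j)%N => i.
rewrite (bigD1 i)//= !natrM mulrAC; congr (_ * _).
rewrite !natr_absz (ger0_norm (ltW (denq_gt0 _))) ger0_norm ?numq_ge0//.
by rewrite mulrC -numqE.
Qed.

End RationalVectors.

Section Polyhedra.
Local Open Scope classical_set_scope.
Variables (R : realType) (s : nat).
Implicit Types (a b e : 'X_{1..s}) (x y z : 'rV[R]_s).
Local Notation vec := (@mnm_vec R s).

Lemma vecD a b : vec (a + b)%MM = vec a + vec b.
Proof. by apply/rowP => j; rewrite !mxE mnmDE natrD. Qed.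

Lemma vec_muln a n : vec (a *+ n)%MM = n%:R *: vec a.
Proof. by apply/rowP => j; rewrite !mxE mulmnE natrM mulrC. Qed.

Lemma dotv_le x y z : (forall j, 0 <= z 0 j) -> (forall j, x 0 j <= y 0 j) ->
  dotv x z <= dotv y z.
Proof. by move=> z0 xy; apply: ler_sum => j _; rewrite ler_wpM2r. Qed.

Lemma inv_vec_ge0 b j : 0 <= inv_vec R b 0 j.
Proof. by rewrite mxE; case: ifP => // _; rewrite invr_ge0. Qed.

Lemma dotv_vec_inv a b :
  dotv (vec a) (inv_vec R b) = (weight (scaled_inv b) a)%:R / (scale b)%:R.
Proof.
rewrite /weight natr_sum mulr_suml; apply: eq_bigr => j _.
rewrite !mxE natrM -mulrA; congr (_ * _).
have [bj|bj] := ltnP 0 (b j); last by rewrite /scaled_inv leqNgt ltnS bj mul0r.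
rewrite -(scaled_invK bj) natrM invfM mulrA divff ?mul1r//.
rewrite pnatr_eq0 -lt0n; have := scale_gt0 b.
by rewrite -(scaled_invK bj) muln_gt0 => /andP[].
Qed.

Lemma le_dotv_vec_inv a b n :
  (n%:R <= dotv (vec a) (inv_vec R b)) =
  (n * scale b <= weight (scaled_inv b) a)%N.
Proof.
by rewrite dotv_vec_inv ler_pdivlMr ?ltr0n ?scale_gt0// -natrM ler_nat.
Qed.

(** The Newton polyhedron of the exponents v, written with inequalities on the
    coefficients so that these range over a polyhedron themselves. *)
Definition newton_of q (v : 'I_q -> 'X_{1..s}) : set 'rV[R]_s :=
  [set x | exists c : 'I_q -> R, [/\ forall i, 0 <= c i, \sum_i c i = 1 &
     forall j, \sum_i c i * (v i j)%:R <= x 0 j]].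

Lemma newton_ofE q (v : 'I_q -> 'X_{1..s}) x : newton_of v x <->
  exists y z, [/\ nonneg_orthant y, conv (fun i => vec (v i)) z & x = y + z].
Proof.
have combE (c : 'I_q -> R) j :
    (\sum_i c i *: vec (v i)) 0 j = \sum_i c i * (v i j)%:R.
  by rewrite summxE; apply: eq_bigr => i _; rewrite !mxE.
split=> [[c [c0 c1 cx]]|[y [z [y0 [c [c0 c1 ->]] ->]]]].
  exists (x - \sum_i c i *: vec (v i)), (\sum_i c i *: vec (v i)); split.
  - by move=> j; rewrite mxE [X in _ + X]mxE combE subr_ge0.
  - by exists c.
  - by rewrite subrK.
by exists c; split=> // j; rewrite mxE combE lerDr.
Qed.

(** The coefficients witnessing that a / n lies in the Newton polyhedron form a
    nonempty polyhedron with rational data, hence contain a rational basic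
    point; clearing its denominators turns the convex combination into a sum
    of N n exponents below N a. *)
Lemma nfold_newton_of q (v : 'I_q -> 'X_{1..s}) n a :
  (0 < n)%N -> newton_of v (n%:R^-1 *: vec a) ->
  exists2 N, (1 <= N)%N &
    exists2 e, nfold (range v) (N * n) e & (e <= a *+ N)%MM.
Proof.
move=> n0 [c [c0 c1 cx]].
(* Constraints on the coefficients: nonnegativity, sum equal to 1 as two
   inequalities, and domination by a / n at each coordinate. *)
pose T := ('I_q + bool + 'I_s)%type.
pose F (k : T) : 'rV[rat]_q := match k with
  | inl (inl i) => delta_mx 0 i
  | inl (inr true) => const_mx 1
  | inl (inr false) => const_mx (- 1)
  | inr j => \row_i - (v i j)%:R end.
pose f (k : T) : rat := match k with
  | inl (inl i) => 0
  | inl (inr true) => 1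
  | inl (inr false) => - 1
  | inr j => - ((a j)%:R / n%:R) end.
pose A k := map_mx (@ratr R) (F k).
have dotA (u : 'rV[R]_q) k : dotv (A k) u = match k with
  | inl (inl i) => u 0 i
  | inl (inr true) => \sum_i u 0 i
  | inl (inr false) => - \sum_i u 0 i
  | inr j => - \sum_i u 0 i * (v i j)%:R end.
  case: k => [[i|[]]|j].
  - by rewrite -[RHS]dotv_deltal /A /F map_delta_mx.
  - by apply: eq_bigr => i _; rewrite !mxE rmorph1 mul1r.
  - by rewrite -sumrN; apply: eq_bigr => i _; rewrite !mxE rmorphN1 mulN1r.
  - rewrite -sumrN; apply: eq_bigr => i _.
    by rewrite !mxE rmorphN rmorph_nat mulNr mulrC.
have pointed u : (forall k, dotv (A k) u = 0) -> u = 0.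
  by move=> u0; apply/rowP => i; have := u0 (inl (inl i)); rewrite dotA mxE.
have [|y By] := @exists_basic_point R q T A (fun k => ratr (f k))
  (\row_i c i) pointed.
  have rowc (w : 'I_q -> R) : \sum_i (\row_i c i) 0 i * w i = \sum_i c i * w i.
    by apply: eq_bigr => i _; rewrite mxE.
  have sumc : \sum_i (\row_i c i) 0 i = 1.
    by rewrite -c1; apply: eq_bigr => i _; rewrite mxE.
  case=> [[i|[]]|j]; rewrite dotA /f.
  - by rewrite rmorph0 mxE.
  - by rewrite rmorph1 sumc.
  - by rewrite rmorphN1 sumc.
  - rewrite rmorphN fmorph_div !rmorph_nat lerN2 rowc.
    by have := cx j; rewrite !mxE mulrC.
have [z yz] := basic_point_rational By.
have {}Py k : ratr (f k) <= dotv (A k) y by case: By => + _; apply.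
have z0 i : 0 <= z 0 i.
  by have := Py (inl (inl i)); rewrite dotA yz mxE (ler_rat R).
have z1 : \sum_i z 0 i = 1.
  apply/eqP; rewrite eq_le.
  have := Py (inl (inr true)); have := Py (inl (inr false)); rewrite !dotA yz.
  have -> : \sum_i (map_mx ratr z) 0 i = ratr (\sum_i z 0 i) :> R.
    by rewrite rmorph_sum; apply: eq_bigr => i _; rewrite mxE.
  by rewrite -rmorphN !ler_rat lerN2 => -> ->.
have zx j : \sum_i z 0 i * (v i j)%:R <= (a j)%:R / n%:R.
  rewrite -(ler_rat R) -lerN2 -rmorphN; have := Py (inr j); rewrite dotA yz.
  congr (_ <= - _); rewrite rmorph_sum; apply: eq_bigr => i _.
  by rewrite mxE rmorphM rmorph_nat.
have [N N0 [k Nk]] := common_denominator z0.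
have sumk : (\sum_i k i)%N = N.
  apply/eqP; rewrite -(eqr_nat rat) natr_sum; apply/eqP.
  rewrite (eq_bigr (fun i => N%:R * z 0 i)) => [|i _]; last by rewrite Nk.
  by rewrite -mulr_sumr z1 mulr1.
exists N => //; exists (\big[+%MM/0%MM]_i (v i *+ (k i * n)))%MM.
  rewrite -{1}sumk big_distrl /=.
  by apply: nfold_sum => i _; exists i.
apply/mnm_lepP => j; rewrite mnm_sumE mulmnE -(ler_nat rat).
have := zx j; rewrite ler_pdivlMr ?ltr0n// => zxj.
rewrite [leRHS]natrM [leRHS]mulrC; apply: le_trans (ler_wpM2l (ler0n _ N) zxj).
rewrite natr_sum mulr_suml mulr_sumr ler_sum// => i _.
by rewrite mulmnE !natrM -Nk le_eqVlt; apply/orP; left; apply/eqP; ring.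
Qed.

End Polyhedra.

(** * The irreducible polyhedron *)

Section IrreduciblePolyhedron.
Local Open Scope classical_set_scope.
Variables (R : realType) (K : fieldType) (s : nat).
Local Notation S := {mpoly K[s]}.
Local Notation vec := (@mnm_vec R s).
Variables (I : set S) (m : nat) (alpha : 'I_m -> 'X_{1..s}).
Hypothesis decI : irreducible_decomposition I alpha.
Local Notation IP := (irreducible_polyhedron R alpha).
Implicit Types (a e : 'X_{1..s}) (x y : 'rV[R]_s) (n : nat).

(** The constraints of the irreducible polyhedron with their rational
    coefficients, to which the rationality of basic points applies. *)
Definition ip_normal (k : 'I_s + 'I_m) : 'rV[rat]_s := match k with
  | inl j => delta_mx 0 j
  | inr i => \row_j (if (1 <= alpha i j)%N then (alpha i j)%:R^-1 else 0) end.

Definition ip_bound (k : 'I_s + 'I_m) : rat := if k is inr _ then 1 else 0.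

Lemma dotv_ip_normal x k : dotv (map_mx ratr (ip_normal k)) x = match k with
  | inl j => x 0 j
  | inr i => dotv x (inv_vec R (alpha i)) end.
Proof.
case: k => [j|i]; first by rewrite map_delta_mx dotv_deltal.
rewrite dotvC; apply: eq_bigr => j _; rewrite !mxE.
by case: ifP => _; rewrite ?rmorph0// fmorphV rmorph_nat.
Qed.

Lemma irreducible_polyhedronE :
  IP = polyhedron (fun k => map_mx ratr (ip_normal k))
                  (fun k => ratr (ip_bound k)).
Proof.
apply/seteqP; split=> [x [x0 x1] [j|i]|x Px].
- by rewrite dotv_ip_normal rmorph0.
- by rewrite dotv_ip_normal rmorph1.
- split=> [j|i]; first by have := Px (inl j); rewrite dotv_ip_normal rmorph0.
  by have := Px (inr i); rewrite dotv_ip_normal rmorph1.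
Qed.

Lemma ip_normal_pointed x :
  (forall k, dotv (map_mx ratr (ip_normal k)) x = 0) -> x = 0.
Proof.
by move=> x0; apply/rowP => j; have := x0 (inl j); rewrite dotv_ip_normal mxE.
Qed.

Lemma exponent_in_ip a : I 'X_[a] -> IP (vec a).
Proof.
move=> aI; split=> [j|i]; first by rewrite mxE.
rewrite (le_dotv_vec_inv R a (alpha i) 1).
apply: (@irr_ideal_pow_weight K).
rewrite ideal_pow1; last exact: irr_ideal_is_ideal.
by move/(mem_decP decI): aI; apply.
Qed.

Lemma newton_of_sub_ip q (v : 'I_q -> 'X_{1..s}) :
  (forall i, I 'X_[v i]) -> newton_of v `<=` IP.
Proof.
move=> vI x [c [c0 c1 cx]]; split=> [j|k].
  by apply: le_trans (cx j); apply: sumr_ge0 => i _; rewrite mulr_ge0.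
apply: (@le_trans _ _ (dotv (\sum_i c i *: vec (v i)) (inv_vec R (alpha k)))).
  rewrite dotvC dotv_sumr -c1; apply: ler_sum => i _.
  by rewrite dotvZr dotvC ler_peMr//; have [_] := exponent_in_ip (vI i).
apply: dotv_le => [j|j]; first exact: inv_vec_ge0.
apply: le_trans (cx j); rewrite summxE le_eqVlt; apply/orP; left.
by apply/eqP/eq_bigr => i _; rewrite !mxE.
Qed.

Lemma mono_generators_mem q (v : 'I_q -> 'X_{1..s}) :
  I = mono_ideal (range v) -> forall i, I 'X_[v i].
Proof.
move=> -> i; apply/mono_idealX; exists (v i); last exact: lepm_refl.
by exists i.
Qed.

Lemma newton_sub_ip : newton_polyhedron R I `<=` IP.
Proof.
move=> x [q [v [[eqI _] /newton_ofE]]].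
exact/newton_of_sub_ip/mono_generators_mem.
Qed.

Hypothesis no_emb : no_embedded_primes I.
Hypothesis rad_neq : forall i j : 'I_m, j <> i ->
  radical (irr_ideal K (alpha j)) <> radical (irr_ideal K (alpha i)).
Hypothesis normal_q : forall i, normal_ideal (irr_ideal K (alpha i)).

(** This is where normality turns the symbolic powers into dilates of the
    irreducible polyhedron. *)
Lemma symbolic_powerX n a : (1 <= n)%N ->
  symbolic_power I n 'X_[a] <-> IP (n%:R^-1 *: vec a).
Proof.
move=> n0; have symbE := symbolic_powerE decI no_emb rad_neq normal_q 'X_[a] n0.
have dotn i : (1 <= dotv (n%:R^-1 *: vec a) (inv_vec R (alpha i))) =
    (n * scale (alpha i) <= weight (scaled_inv (alpha i)) a)%N.
  rewrite dotvC dotvZr dotvC mulrC ler_pdivlMr ?ltr0n// mul1r.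
  exact: le_dotv_vec_inv.
split=> [/symbE aI|[_ aP]].
  split=> [j|i]; first by rewrite !mxE mulr_ge0 ?invr_ge0.
  by rewrite dotn; apply: irr_ideal_pow_weight (aI i).
apply/symbE => i; apply/(normal_irr_ideal_powX a (normal_q i) n0).
by rewrite -dotn.
Qed.

Lemma ip_exponent a : IP (vec a) -> I 'X_[a].
Proof.
rewrite -[vec a]scale1r -invr1 => /(symbolic_powerX _ (n := 1)) aI.
apply/(mem_decP decI) => i; rewrite -(ideal_pow1 (irr_ideal_is_ideal _ _)).
apply: (iffLR (symbolic_powerE decI no_emb rad_neq normal_q _ _)) => //.
exact: aI.
Qed.

(** Each vertex, being integral, is an exponent of I, and the Newton polyhedron
    is convex and closed under adding nonnegative vectors: generation by
    vertices gives the inclusion of IP in NP. *)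
Lemma integral_ip_newton : integral_polyhedron IP -> newton_polyhedron R I = IP.
Proof.
move=> intIP; apply/seteqP; split; first exact: newton_sub_ip.
have [q [v minv]] := dec_generators decI.
suff ipv : IP `<=` newton_of v.
  by move=> x /ipv/newton_ofE xv; exists q, v.
rewrite irreducible_polyhedronE; apply: polyhedron_ind.
- move=> x xb; have xv := basic_point_vertex xb.
  rewrite -irreducible_polyhedronE in xv.
  have xP : IP x by rewrite irreducible_polyhedronE; case: xb.
  have /fin_all_exists[a xa] : forall j, exists k : nat, x 0 j = k%:R.
    move=> j; apply/natrP; rewrite natrEint intIP//=.
    by case: xP => /(_ j).
  have {}xa : x = vec [multinom a j | j < s].
    by apply/rowP => j; rewrite xa !mxE mnmE.
  rewrite xa in xP *; have := ip_exponent xP.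
  case: minv => -> _ /mono_idealX[_ [i _ <-] lev].
  exists (fun k => (k == i)%:R); split=> [k||j].
  + by rewrite ler0n.
  + by rewrite (bigD1 i)//= eqxx big1 ?addr0// => k /negPf ->.
  + rewrite (bigD1 i)//= eqxx mul1r big1 ?addr0.
      by rewrite mxE ler_nat; apply/mnm_lepP.
    by move=> k /negPf ->; rewrite mul0r.
- move=> x y a /andP[a0 a1] [c [c0 c1 cx]] [d [d0 d1 dy]].
  exists (fun i => a * c i + (1 - a) * d i); split=> [i||j].
  + by rewrite addr_ge0// mulr_ge0// subr_ge0.
  + by rewrite big_split -!mulr_sumr c1 d1 /=; ring.
  + rewrite !mxE (eq_bigr (fun i => a * (c i * (v i j)%:R) +
      (1 - a) * (d i * (v i j)%:R))); last by move=> i _; ring.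
    by rewrite big_split -!mulr_sumr lerD// ler_wpM2l// subr_ge0.
- move=> x u u0 [c [c0 c1 cx]]; exists c; split=> // j.
  by rewrite mxE ler_wpDr//; have := u0 (inl j); rewrite dotv_ip_normal.
- exact: ip_normal_pointed.
Qed.

(** Normality of the components bounds the closure from above. Conversely, for
    each monomial t ^ a of an element of the symbolic power, a / n lies in
    IP = NP, so that a power of t ^ a lies in the corresponding power of I ^ n,
    and the element is a sum of such terms. *)
Lemma newton_closure_symbolic : newton_polyhedron R I = IP ->
  forall n, (1 <= n)%N -> integral_closure (ideal_pow I n) = symbolic_power I n.
Proof.
move=> NPE n n0; apply/seteqP; split=> f.
  move=> fI; apply/(symbolic_powerE decI) => // i.
  rewrite (normal_q i)//; apply: integral_closure_mono fI.
  by apply: ideal_pow_mono => g /(mem_decP decI).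
move=> /(symbolic_powerE decI no_emb rad_neq normal_q f n0) fI.
rewrite [f]mpolyE; apply: integral_closure_sum_roots => a af.
have : newton_polyhedron R I (n%:R^-1 *: vec a).
  rewrite NPE; apply/(symbolic_powerX a n0)/(symbolic_powerE decI) => // i.
  move: (fI i); rewrite irr_ideal_mono => /mono_ideal_pow_msupp; exact.
case=> q [v [[eqI _] /newton_ofE/nfold_newton_of-/(_ n0)[N N0 [e Ne lea]]]].
exists N => //; rewrite exprZn mpolyXn eqI mono_ideal_pow_pow mono_ideal_pow.
rewrite -mul_mpolyC; have [_ _] := ideal_gen_is_ideal
  [set ('X_[a] : S) | a in nfold (range v) (N * n)].
by apply; apply/mono_idealX; exists e.
Qed.

Lemma nfold_minimum E n e (c : 'rV[R]_s) beta :
    (forall a, E a -> beta <= dotv c (vec a)) -> nfold E n e ->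
  n%:R * beta <= dotv c (vec e).
Proof.
move=> cE; elim: n e => [_ ->|n IHn _ [x Ex [y Ey <-]]].
  rewrite mul0r le_eqVlt; apply/orP; left; apply/eqP/esym.
  by apply: big1 => j _; rewrite mxE mnm0E mulr0.
by rewrite vecD dotvDr -natr1 mulrDl mul1r addrC lerD ?cE// IHn.
Qed.

(** A vertex x is rational, say x = a / n, so t ^ a is in the n-th symbolic
    power and thus integral over I ^ n: a positive multiple of x dominates a
    sum of as many exponents of I. These lie in IP, and the linear form
    minimized only at x is nonnegative, so each of them is equal to x. *)
Lemma closure_symbolic_integral_ip :
  (forall n, (1 <= n)%N ->
     integral_closure (ideal_pow I n) = symbolic_power I n) ->
  integral_polyhedron IP.
Proof.
move=> clI x xv.
have [c [beta [cmin face]]] := xv.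
have [xP cx] : IP x /\ dotv c x = beta.
  by have : [set x] x by []; rewrite -face.
(* IP is closed under adding unit vectors, on which c cannot be negative. *)
have c0 j : 0 <= c 0 j.
  have /cmin : IP (x + delta_mx 0 j).
    case: xP => x0 x1; split=> [k|k].
      by rewrite !mxE addr_ge0.
    apply: le_trans (x1 k) _; apply: dotv_le => l; first exact: inv_vec_ge0.
    by rewrite !mxE lerDl.
  by rewrite dotvDr cx lerDl dotvC dotv_deltal.
have [y xy] : exists y : 'rV[rat]_s, x = map_mx ratr y.
  apply: (basic_point_rational (A := ip_normal) (b := ip_bound)).
  by apply: vertex_basic_point; rewrite -irreducible_polyhedronE.
have y0 i : 0 <= y 0 i.
  by case: xP => /(_ i) + _; rewrite xy mxE ler0q.
have [n n0 [w yw]] := common_denominator y0.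
pose a := [multinom w i | i < s].
have na : vec a = n%:R *: x.
  apply/rowP => i; rewrite xy !mxE mnmE -(ratr_nat R (w i)) -yw.
  by rewrite rmorphM rmorph_nat.
have /(symbolic_powerX a n0) : IP (n%:R^-1 *: vec a).
  by rewrite na scalerA mulVf ?scale1r// pnatr_eq0 -lt0n.
rewrite -clI// {1}(dec_mono decI) => /integral_closure_mono_pow[i i0 [e]].
have ce : dotv c (vec (a *+ i)%MM) = (i * n)%:R * beta.
  by rewrite vec_muln na scalerA dotvZr cx natrM.
have in0 : (0 < i * n)%N by rewrite muln_gt0 i0.
case: (i * n)%N in0 ce => // k _ ce [e1 E1 [e2 E2 <-]] lea.
have exponentmin b : exponents I b -> beta <= dotv c (vec b).
  by move=> /exponent_in_ip/cmin.
suff <- : vec e1 = x by move=> j; rewrite mxE.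
suff : [set x] (vec e1) by [].
rewrite -face; split; first exact: exponent_in_ip.
have := nfold_minimum exponentmin E2.
have : dotv c (vec (e1 + e2)%MM) <= k.+1%:R * beta.
  rewrite -ce dotvC [leRHS]dotvC; apply: dotv_le => // j.
  by rewrite !mxE ler_nat; apply/mnm_lepP.
have := exponentmin _ E1.
rewrite vecD dotvDr -natr1 => ? ? ?.
by apply/eqP; rewrite eq_le; apply/andP; split; lra.
Qed.

End IrreduciblePolyhedron.

Theorem theorem7p8 (R : realType) (K : fieldType) (s : nat)
    (I : set {mpoly K[s]}) (m : nat) (alpha : 'I_m -> 'X_{1..s})
    (monoI : monomial_ideal I)
    (decI : irreducible_decomposition I alpha)
    (no_emb : no_embedded_primes I)
    (rad_neq : forall i j : 'I_m, j <> i ->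
       radical (irr_ideal K (alpha j)) <> radical (irr_ideal K (alpha i)))
    (normal_q : forall i : 'I_m, normal_ideal (irr_ideal K (alpha i))) :
  [<-> integral_polyhedron (irreducible_polyhedron R alpha);
       newton_polyhedron R I = irreducible_polyhedron R alpha;
       forall n : nat, (1 <= n)%N ->
         integral_closure (ideal_pow I n) = symbolic_power I n].
Proof.
tfae.
- exact: (integral_ip_newton decI no_emb rad_neq normal_q).
- exact: (newton_closure_symbolic decI no_emb rad_neq normal_q).
- exact: (closure_symbolic_integral_ip decI no_emb rad_neq normal_q).
Qed.
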